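(* For every positive integer $d$ there exists a constant $C_d$, depending only on $d$, such that the following holds. Let $\mathbb{F}$ be a field, let $L_1,\dots,L_d$ be pairwise disjoint collections of lines in $\mathbb{F}^d$, and suppose that the family $\mathcal{L}=\{L_1,\dots,L_d\}$ is generic. Let $J$ be a finite set of multijoints of $\mathcal{L}$. Then there exists a $d$-colouring $\kappa: J\to\{1,2,\dots,d\}$ such that for each $j\in\{1,\dots,d\}$ and each line $l\in L_j$, $$|\{x\in J\cap l : \kappa(x)=j\}|\leq C_d\,|J|^{1/d}.$$
   Context: Let $\mathbb{F}$ be a field and let $\mathcal{L}=\{L_1,\dots,L_d\}$ where $L_1,\dots,L_d$ are pairwise disjoint collections of lines (one-dimensional affine subspaces) in $\mathbb{F}^d$. A point $x\in\mathbb{F}^d$ is a multijoint of $\mathcal{L}$ if $x$ lies on a line from each of the collections $L_1,\dots,L_d$, and moreover the directions of these lines span $\mathbb{F}^d$; that is, there are lines $l_j\in L_j$ ($j=1,\dots,d$) with $x\in l_j$ for all $j$ whose directions span $\mathbb{F}^d$. The family $\mathcal{L}$ is generic if whenever lines $l_1\in L_1,\dots,l_d\in L_d$ meet at a common point $x$, the directions of $l_1,\dots,l_d$ span $\mathbb{F}^d$. A $d$-colouring of $J$ is an arbitrary function $\kappa:J\to\{1,2,\dots,d\}$. $|S|$ denotes the cardinality of a finite set $S$. The constant $C_d$ does not depend on $\mathbb{F}$, $\mathcal{L}$ or $J$. *)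

(* Defs.v *)
From HB Require Import structures.
From mathcomp Require Import all_boot all_order all_algebra finmap.
From mathcomp Require Import boolp classical_sets reals exp.
Set Implicit Arguments.
Unset Strict Implicit.
Unset Printing Implicit Defensive.
Import Order.TTheory GRing.Theory Num.Theory.
Local Open Scope classical_set_scope.
Local Open Scope ring_scope.

(* Points of F^d are row vectors.  Lines are sets of points, and a collection
   of lines is an arbitrary, possibly infinite, set of such sets. *)
Section Multijoints.
Variables (F : fieldType) (d : nat).
Implicit Types (p x : 'rV[F]_d) (U : {vspace 'rV[F]_d}) (l : set 'rV[F]_d).

Definition affine_subspace p U : set 'rV[F]_d := [set x | x - p \in U].

Definition has_direction l U : Prop := exists p, l = affine_subspace p U.

Definition is_line l : Prop := exists2 U, \dim U = 1%N & has_direction l U.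

Lemma has_direction_inj l U V : has_direction l U -> has_direction l V -> U = V.
Proof.
suff sub W W' : has_direction l W -> has_direction l W' -> (W <= W')%VS.
  move=> lU lV; apply/eqP; rewrite eqEsubv.
  by apply/andP; split; apply: sub.
move=> [p lp] [q lq]; apply/subvP => w wW.
have : l (p + w) by rewrite lp /affine_subspace /= addrAC subrr add0r.
have : l p by rewrite lp /affine_subspace /= subrr mem0v.
rewrite lq /affine_subspace /= => pq pwq.
by have := rpredB pwq pq; rewrite opprB addrA subrK addrAC subrr add0r.
Qed.

(* The subspaces U j are determined by the l j, by has_direction_inj. *)
Definition directions_span (l : 'I_d -> set 'rV[F]_d) : Prop :=
  exists2 U : 'I_d -> {vspace 'rV[F]_d},
    forall j, has_direction (l j) (U j) & (\sum_j U j)%VS = fullv.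

Definition multijoint (L : 'I_d -> set (set 'rV[F]_d)) x : Prop :=
  exists l : 'I_d -> set 'rV[F]_d,
    [/\ forall j, L j (l j), forall j, l j x & directions_span l].

Definition generic (L : 'I_d -> set (set 'rV[F]_d)) : Prop :=
  forall l : 'I_d -> set 'rV[F]_d, (forall j, L j (l j)) ->
  forall x, (forall j, l j x) -> directions_span l.

End Multijoints.

(* Main.v *)
Require Import Defs.
From HB Require Import structures.
From mathcomp Require Import all_boot all_order all_algebra finmap.
From mathcomp Require Import boolp classical_sets reals exp.
From mathcomp Require Import mpoly zify.
Set Implicit Arguments.
Unset Strict Implicit.
Unset Printing Implicit Defensive.
Import Order.TTheory GRing.Theory Num.Theory.
Local Open Scope classical_set_scope.
Local Open Scope ring_scope.

(** The colouring is built greedily from one fact: a finite nonempty set [J] of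
    points, with [#|J| < (k+1)^d], contains a point [x] that has a colour [j]
    for which every line of [L j] through [x] contains at most [d * k] points of
    [J] ([exists_point_on_poor_lines]).  Colour [J] minus [x] by induction and
    give [x] the colour [j]: a line of [L j] through [x] cannot have too many
    points of colour [j], since it has few points of [J] altogether, and on the
    other lines no count of points of the relevant colour changes.  With [k] the
    integer part of the [d]-th root of [#|J|], the constant [d] works.

    The fact is proved by the polynomial method.  Polynomials of degree at most
    [k] in each variable form a space of dimension [(k+1)^d > #|J|], so some
    nonzero [P] of total degree at most [d * k] vanishes on [J]
    ([exists_vanishing_poly]).  Take [P] of least degree.  Then the gradient of
    [P] does not vanish on all of [J] ([regular_vanishing_poly]): otherwise each
    partial derivative, being of lower degree, is the zero polynomial, which is
    possible for a nonconstant [P] only in characteristic [p], with all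
    exponents of [P] divisible by [p].  Over a perfect field [P] would then be a
    [p]-th power and its root would have lower degree; over an arbitrary field a
    rank argument replaces the root ([frobenius_root]).

    So let the gradient of [P] at [x] be nonzero.  If each [L j] had a line
    through [x] in whose direction [P] has derivative zero at [x], these
    directions would span the space by genericity and the gradient would be
    zero.  Hence for some [j] the derivative of [P] at [x] along every line of
    [L j] through [x] is nonzero; [P] restricted to such a line is a nonzero
    polynomial of degree at most [d * k] that vanishes at the points of [J] on
    it ([count_line_lt]). *)

(** * Polynomials of low degree vanishing on a finite set *)

Section Vanishing.
Variables (F : fieldType) (d : nat).
Implicit Types (P Q : {mpoly F[d]}) (J : seq 'rV[F]_d).

Definition vanishes_on J P := forall x, x \in J -> P.@[x 0] = 0.

Definition monomial_comb n (M : 'I_n -> 'X_{1..d}) (c : 'rV[F]_n) :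
  {mpoly F[d]} := \sum_i c 0 i *: 'X_[M i].

Definition monomial_eval_mx n (M : 'I_n -> 'X_{1..d}) J : 'M[F]_(n, size J) :=
  \matrix_(i, j) ('X_[M i] : {mpoly F[d]}).@[tnth (in_tuple J) j 0].

Lemma monomial_comb_eval n (M : 'I_n -> 'X_{1..d}) J c j :
  (monomial_comb M c).@[tnth (in_tuple J) j 0] = (c *m monomial_eval_mx M J) 0 j.
Proof.
rewrite raddf_sum mxE; apply: eq_bigr => i _ /=.
by rewrite mevalZ mxE.
Qed.

Lemma mcoeff_monomial_comb n (M : 'I_n -> 'X_{1..d}) c i :
  injective M -> (monomial_comb M c)@_(M i) = c 0 i.
Proof.
move=> injM; rewrite raddf_sum /= (bigD1 i) //= mcoeffZ mcoeffX eqxx mulr1.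
rewrite big1 ?addr0 // => j ji.
by rewrite mcoeffZ mcoeffX (inj_eq injM) (negPf ji) mulr0.
Qed.

Lemma msupp_monomial_comb n (M : 'I_n -> 'X_{1..d}) c m :
  m \in msupp (monomial_comb M c) -> exists i, m = M i.
Proof.
rewrite mcoeff_msupp raddf_sum /= => nz; apply: contrapT => nM.
case/eqP: nz; apply: big1 => i _; rewrite mcoeffZ mcoeffX.
by case: eqP => [Mi|_]; rewrite ?mulr0 //; case: nM; exists i.
Qed.

Lemma vanishing_poly_of_dependence n (M : 'I_n -> 'X_{1..d}) J :
  injective M -> ~~ row_free (monomial_eval_mx M J) ->
  exists P, [/\ P != 0, vanishes_on J P
    & forall m, m \in msupp P -> exists i, m = M i].
Proof.
move=> injM; rewrite -kermx_eq0 => /rowV0Pn [c /sub_kermxP cA nzc].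
exists (monomial_comb M c); split; last exact: msupp_monomial_comb.
  apply: contra_neq nzc => c0; apply/rowP => i.
  by rewrite -(mcoeff_monomial_comb c i injM) c0 mcoeff0 mxE.
by move=> x /(tnthP (in_tuple J)) [j ->]; rewrite monomial_comb_eval cA mxE.
Qed.

(** There are more monomials with all exponents at most [k] than points. *)
Lemma exists_vanishing_poly k J : (size J < k.+1 ^ d)%N ->
  exists P, [/\ P != 0, vanishes_on J P & (msize P <= (d * k).+1)%N].
Proof.
move=> Nk.
pose mon (f : {ffun 'I_d -> 'I_k.+1}) : 'X_{1..d} := [multinom (f i : nat) | i < d].
have injmon : injective mon.
  move=> f g /mnmP fg; apply/ffunP => i; apply: val_inj.
  by have := fg i; rewrite !mnmE.
pose M (i : 'I_#|{ffun 'I_d -> 'I_k.+1}|) := mon (enum_val i).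
have injM : injective M by move=> i j /injmon /enum_val_inj.
have dep : ~~ row_free (monomial_eval_mx M J).
  apply/negP => /eqP rk; have := rank_leq_col (monomial_eval_mx M J).
  by rewrite rk card_ffun !card_ord leqNgt Nk.
have [P [nzP PJ MP]] := vanishing_poly_of_dependence injM dep.
exists P; split=> //; rewrite mmeasureE; apply/bigmax_leqP_seq => m /MP [i ->] _.
rewrite ltnS /= mdegE -[X in (_ <= X * _)%N]card_ord -sum_nat_const.
by apply: leq_sum => j _; rewrite mnmE -ltnS.
Qed.

Lemma monomial_comb_msupp P :
  monomial_comb (tnth (in_tuple (msupp P)))
    (\row_i P@_(tnth (in_tuple (msupp P)) i)) = P.
Proof.
rewrite [RHS]mpolyE big_tnth; apply: eq_bigr => i _; by rewrite mxE.
Qed.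

(** A surrogate for the [p]-th root of [P], which need not exist if [F] is not
    perfect.  Writing the exponents of [P] as [p] times the monomials [M], the
    values of the monomials of [P] at the points of [J] form the image under
    Frobenius of the matrix of values of [M].  A field morphism preserves rank,
    so the relation given by the coefficients of [P] forces a relation
    between the monomials [M]; its coefficients are those of [Q]. *)
Lemma frobenius_root p J P : p \in [pchar F] ->
  P != 0 -> vanishes_on J P ->
  (forall m i, m \in msupp P -> (p %| m i)%N) ->
  exists Q, [/\ Q != 0, vanishes_on J Q
    & forall m, m \in msupp Q -> (m *+ p)%MM \in msupp P].
Proof.
move=> pF nzP PJ pP; have p_gt0 := prime_gt0 (pcharf_prime pF).
pose e := tnth (in_tuple (msupp P)).
pose M i : 'X_{1..d} := [multinom (e i j %/ p)%N | j < d].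
have MK i : (M i *+ p)%MM = e i.
  by apply/mnmP => j; rewrite mulmnE mnmE divnK // pP // mem_tnth.
have injM : injective M.
  move=> i j /(congr1 (fun m => (m *+ p)%MM)); rewrite !MK.
  have /uniqP U := msupp_uniq P.
  rewrite /e !(tnth_nth 0%MM) => /U /=; rewrite !inE => eij.
  exact/val_inj/eij.
have dep : ~~ row_free (monomial_eval_mx M J).
  rewrite -(row_free_map (pFrobenius_aut pF)).
  have -> : map_mx (pFrobenius_aut pF) (monomial_eval_mx M J)
          = monomial_eval_mx e J.
    apply/matrixP => i j; rewrite !mxE pFrobenius_autE -MK !mevalX -prodrXl.
    by apply: eq_bigr => a _; rewrite mulmnE exprM.
  pose c := \row_i P@_(e i).
  apply/negP => /(mulmx_free_eq0 c) cA.
  have /eqP c0 : c == 0.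
    rewrite -cA; apply/eqP/rowP => j.
    by rewrite -monomial_comb_eval monomial_comb_msupp PJ ?mxE ?mem_tnth.
  case/eqP: nzP; rewrite -(monomial_comb_msupp P) -/e -/c c0.
  by apply: big1 => i _; rewrite mxE scale0r.
have [Q [nzQ QJ MQ]] := vanishing_poly_of_dependence injM dep.
exists Q; split=> // m /MQ [i ->]; rewrite MK; exact: mem_tnth.
Qed.

Lemma msize_mderiv_lt P i : P != 0 -> (msize P^`M(i) < msize P)%N.
Proof.
move=> nzP; have [->|nz] := eqVneq P^`M(i) 0.
  by rewrite mmeasure0 lt0n mmeasure_poly_eq0.
rewrite -(mlead_deg nz); have := mlead_supp nz.
rewrite mcoeff_msupp mcoeff_deriv => nzc.
have : (mlead P^`M(i) + U_(i))%MM \in msupp P.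
  by rewrite mcoeff_msupp; apply: contra_neq nzc => ->; rewrite mul0rn.
by move/msize_mdeg_lt; rewrite mdegD mdeg1 addn1.
Qed.

Lemma mderiv_eq0_msupp P i m : P^`M(i) = 0 -> m \in msupp P ->
  (m i)%:R = 0 :> F.
Proof.
move=> P0; rewrite mcoeff_msupp => nzm; have [->//|mi] := posnP (m i).
have Um : (U_(i) <= m)%MM by rewrite lep1mP -lt0n.
have := congr1 (mcoeff (m - U_(i))%MM) P0.
rewrite mcoeff_deriv mcoeff0 submK // mnmBE mnm1E eqxx subn1 prednK //.
by move/eqP; rewrite -[_ *+ _]mulr_natr mulf_eq0 (negPf nzm) => /eqP.
Qed.

(** Some exponent [m i] of the leading monomial is positive while [(m i)%:R = 0],
    so the characteristic is some [p > 0] and [frobenius_root] applies. *)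
Lemma lower_degree_of_gradient0 J P :
  J != [::] -> P != 0 -> vanishes_on J P -> (forall i, P^`M(i) = 0) ->
  exists Q, [/\ Q != 0, vanishes_on J Q & (msize Q < msize P)%N].
Proof.
move=> J0 nzP PJ dP.
have P1 : (1 < msize P)%N.
  rewrite ltnNge; apply/negP => /msize1_polyC PC.
  have [x xJ] : exists x, x \in J.
    by exists (head 0 J); case: J J0 {PJ} => //= *; exact: mem_head.
  have := PJ x xJ.
  by rewrite PC mevalC => P0; move: nzP; rewrite PC P0 mpolyC0 eqxx.
have /existsP [i mi] : [exists i, mlead P i != 0%N].
  rewrite -negb_forall; apply: contraTN P1 => /forallP m0.
  rewrite -(mlead_deg nzP) -leqNgt ltnS mdegE big1 // => i _.
  exact/eqP.
have mdvd m j : m \in msupp P -> (m j)%:R = 0 :> F.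
  exact: mderiv_eq0_msupp (dP j).
have [p pF] : exists p, p \in [pchar F].
  apply: (@natf0_pchar _ (mlead P i)); first by rewrite lt0n.
  by rewrite mdvd ?mlead_supp.
have pP m j : m \in msupp P -> (p %| m j)%N.
  by move=> mP; rewrite (dvdn_pcharf pF) mdvd.
have [Q [nzQ QJ QP]] := frobenius_root pF nzP PJ pP.
exists Q; split=> //; have := msize_mdeg_lt (QP _ (mlead_supp nzQ)).
rewrite mdegMn -(mlead_deg nzQ); case: (mdeg _) => // e; apply: leq_ltn_trans.
have := prime_gt1 (pcharf_prime pF); nia.
Qed.

(** If the gradient of [P] vanishes on [J], a nonzero partial derivative, or else
    [lower_degree_of_gradient0], gives a polynomial of lower degree that still
    vanishes on [J]; so descent on the degree terminates at some [Q] as wanted. *)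
Lemma regular_vanishing_poly J P :
  J != [::] -> P != 0 -> vanishes_on J P ->
  exists Q, [/\ vanishes_on J Q, (msize Q <= msize P)%N
    & exists2 x, x \in J & exists i, (Q^`M(i)).@[x 0] != 0].
Proof.
move=> J0; have [s] := ubnP (msize P); elim: s P => // s IH P Ps nzP PJ.
have lower Q : Q != 0 -> vanishes_on J Q -> (msize Q < msize P)%N ->
    exists Q', [/\ vanishes_on J Q', (msize Q' <= msize P)%N
      & exists2 x, x \in J & exists i, (Q'^`M(i)).@[x 0] != 0].
  move=> nzQ QJ QP; have [|Q' [Q'J Q'Q Q'r]] := IH Q _ nzQ QJ.
    exact: leq_trans QP _.
  by exists Q'; split=> //; apply: leq_trans Q'Q (ltnW QP).
case: (pselect (exists2 x, x \in J & exists i, (P^`M(i)).@[x 0] != 0)) => [Pr|Pr].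
  by exists P.
have dJ i : vanishes_on J P^`M(i).
  by move=> x xJ; apply/eqP/negPn/negP => nz; apply: Pr; exists x => //; exists i.
case: (pselect (exists i, P^`M(i) != 0)) => [[i nzi]|dP].
  exact: lower nzi (dJ i) (msize_mderiv_lt i nzP).
have [|Q [nzQ QJ QP]] := lower_degree_of_gradient0 J0 nzP PJ.
  by move=> i; apply/eqP/negPn/negP => nz; apply: dP; exists i.
exact: lower QP.
Qed.

End Vanishing.

(** * Restriction of a polynomial to a line *)

Section Lines.
Variables (F : fieldType) (d : nat).
Implicit Types (P Q : {mpoly F[d]}) (J : seq 'rV[F]_d) (x v : 'rV[F]_d).

Definition along_line x v : {mpoly F[d]} -> {poly F} :=
  mmap polyC (fun i => (x 0 i)%:P + v 0 i *: 'X).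

Lemma horner_along_line x v P t : (along_line x v P).[t] = P.@[(x + t *: v) 0].
Proof.
rewrite mevalE horner_sum; apply: eq_bigr => m _.
rewrite hornerM hornerC horner_prod; congr (_ * _); apply: eq_bigr => i _.
by rewrite horner_exp hornerD hornerC hornerZ hornerX !mxE [t * _]mulrC.
Qed.

Lemma size_along_line x v P : (size (along_line x v P) <= msize P)%N.
Proof.
apply: leq_trans (size_sum _ _ _) _; rewrite mmeasureE.
apply/bigmax_leqP_seq => m mP _.
apply: leq_trans (leq_bigmax_seq _ mP isT); rewrite mul_polyC.
apply: leq_trans (size_scale_leq _ _) _; rewrite /= mdegE /mmap1.
elim/big_rec2: _ => [|i e q _ IH]; first by rewrite size_polyC oner_eq0.
apply: leq_trans (size_polyMleq _ _) _.
set h := _ + _ *: 'X; have h2 : (size h <= 2)%N.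
  apply: leq_trans (size_polyD _ _) _; rewrite geq_max size_polyC.
  rewrite (leq_trans (leq_b1 _)) //=.
  by apply: leq_trans (size_scale_leq _ _) _; rewrite size_polyX.
have hm : (size (h ^+ m i) <= (m i).+1)%N.
  apply: leq_trans (size_poly_exp_leq _ _) _; rewrite ltnS.
  by rewrite -[leqRHS]mul1n leq_mul2r -subn1 leq_subLR h2 orbT.
by rewrite -subn1 leq_subLR add1n -addSn -addnS leq_add.
Qed.

(** The chain rule.  Both sides, as functions of [P], are linear derivations over
    the ring morphism [along_line x v], so it is enough to check the
    variables. *)
Lemma deriv_along_line x v P :
  (along_line x v P)^`() = \sum_i v 0 i *: along_line x v P^`M(i).
Proof.
have lD p q : along_line x v (p + q) = along_line x v p + along_line x v q.
  exact: mmapD.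
have lZ c p : along_line x v (c *: p) = c *: along_line x v p.
  by rewrite -mul_polyC; apply: mmapZ.
have l0 : along_line x v 0 = 0 by exact: mmap0.
have [lM l1] := mmap_is_multiplicative
  (fun i => (x 0 i)%:P + v 0 i *: 'X) (polyC : {rmorphism F -> {poly F}}).
pose chain p :=
  (along_line x v p)^`() = \sum_i v 0 i *: along_line x v p^`M(i).
have chainM p q : chain p -> chain q -> chain (p * q).
  rewrite /chain /along_line => cp cq.
  rewrite lM derivM cp cq mulr_suml mulr_sumr -big_split /=.
  apply: eq_bigr => i _; rewrite mderivM mmapD !lM.
  by rewrite scalerDr scalerAl scalerAr.
have chain1 : chain 1.
  rewrite /chain {1}/along_line l1 derivC big1 // => i _.
  by rewrite mderivC l0 scaler0.
have chainX i : chain 'X_i.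
  rewrite /chain {1}/along_line mmapX mmap1U derivD derivC add0r derivZ derivX.
  rewrite (bigD1 i) //= big1 => [|j ji].
    rewrite mderivX mnm1E eqxx scale1r addr0; congr (_ *: _).
    have -> : (U_(i) - U_(i) = 0)%MM by apply/mnmP => j; rewrite mnmBE subnn mnm0E.
    by rewrite mpolyX0 /along_line l1.
  by rewrite mderivX mnm1E eq_sym (negPf ji) scale0r l0 scaler0.
rewrite -/(chain P); elim/mpolyind: P => [|c m p _ _ IH].
  by rewrite /chain l0 deriv0 big1 // => i _; rewrite mderiv0 l0 scaler0.
have cm : chain 'X_[m].
  rewrite mpolyXE_id; elim/big_ind: _ => [|p1 p2|i _]; [exact: chain1|exact: chainM|].
  elim: (m i) => [|e IHe]; first exact: chain1.
  by rewrite exprS; apply: chainM.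
move: IH cm; rewrite /chain => IH cm.
rewrite lD derivD IH lZ derivZ cm scaler_sumr -big_split /=.
apply: eq_bigr => i _; rewrite mderivD mderivZ lD lZ scalerDr.
by rewrite !scalerA mulrC.
Qed.

Definition dir_deriv P x v : F := \sum_i v 0 i * (P^`M(i)).@[x 0].

(** The derivative of [P] at [x] in the direction [v] is the derivative at [0] of
    the restriction of [P] to the line, which is therefore a nonzero polynomial;
    the parameters of the points of [J] on [l] are distinct roots of it. *)
Lemma count_line_lt P J (l : set 'rV[F]_d) U x v : uniq J ->
  vanishes_on J P -> \dim U = 1%N -> has_direction l U -> l x -> v \in U ->
  dir_deriv P x v != 0 ->
  (count (fun y => `[< l y >]) J < msize P)%N.
Proof.
move=> uJ PJ dimU [p lE] lx vU gv.
have nzv : v != 0.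
  apply: contra_neq gv => ->; apply: big1 => i _; by rewrite mxE mul0r.
have UE : U = <[v]>%VS.
  by apply/esym/eqP; rewrite eqEdim -memvE vU dim_vline nzv dimU.
have on_line y : l y -> exists t, y = x + t *: v.
  move: lx; rewrite lE /affine_subspace /= => xU yU.
  have : y - x \in U.
    have -> : y - x = (y - p) - (x - p) by rewrite opprB addrA subrK.
    exact: memvB.
  rewrite UE => /vlineP [t yx].
  by exists t; rewrite -yx addrC subrK.
pose q := along_line x v P.
have nzq : q != 0.
  apply: contra_neq gv => q0.
  have := congr1 (fun r => r^`().[0]) q0; rewrite deriv0 horner0 deriv_along_line.
  rewrite horner_sum => <-; apply: eq_bigr => i _.
  by rewrite hornerZ horner_along_line scale0r addr0.
pose s := [seq y <- J | `[< l y >]].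
have sJ y : y \in s -> y \in J /\ l y.
  by rewrite mem_filter => /andP [/asboolP].
(* The parameter of a point of [l]; [0] is a default value off the line. *)
pose tm y := xget 0 [set t | y = x + t *: v].
have tmK : {in s, forall y, y = x + tm y *: v}.
  move=> y /sJ [_ /on_line [t yt]]; rewrite /tm.
  by case: xgetP => [u _ //|/(_ t)].
have us : uniq (map tm s).
  rewrite map_inj_in_uniq ?filter_uniq // => y z ys zs tyz.
  by rewrite (tmK _ ys) (tmK _ zs) tyz.
rewrite -size_filter -/s -(size_map tm).
apply: leq_trans (size_along_line x v P); apply: max_poly_roots => //.
apply/allP => _ /mapP [y ys ->]; rewrite /root horner_along_line.
by rewrite -(tmK _ ys) PJ //; case: (sJ _ ys).
Qed.

Lemma gradient_eq0_of_full_span P x (U : 'I_d -> {vspace 'rV[F]_d}) :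
  (\sum_j U j)%VS = fullv -> (forall j v, v \in U j -> dir_deriv P x v = 0) ->
  forall i, (P^`M(i)).@[x 0] = 0.
Proof.
move=> sumU PU i.
have /memv_sumP [u uU uE] : delta_mx 0 i \in (\sum_j U j)%VS.
  by rewrite sumU memvf.
have -> : (P^`M(i)).@[x 0] = dir_deriv P x (delta_mx 0 i).
  rewrite /dir_deriv (bigD1 i) //= mxE !eqxx mul1r big1 ?addr0 // => j ji.
  by rewrite mxE (negPf ji) mul0r.
rewrite uE; under [dir_deriv _ _ _]eq_bigr do rewrite summxE mulr_suml.
rewrite exchange_big big1 //= => j _; exact: PU (uU j isT).
Qed.

End Lines.

(** * The colouring *)

Section Colouring.
Variables (F : fieldType) (d : nat).
Implicit Types (J : seq 'rV[F]_d) (x : 'rV[F]_d).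
Variable L : 'I_d -> set (set 'rV[F]_d).
Hypothesis L_line : forall j l, L j l -> is_line l.
Hypothesis L_generic : generic L.

(** Otherwise, at a point [x] of [J] where the gradient of the vanishing polynomial
    is nonzero, each colour would have a line through [x] rich enough for the
    derivative at [x] in its direction to vanish; generic directions span. *)
Lemma exists_point_on_poor_lines k J :
  uniq J -> J != [::] -> (size J < k.+1 ^ d)%N ->
  exists2 x, x \in J & exists j, forall l, L j l -> l x ->
    (count (fun y => `[< l y >]) J <= d * k)%N.
Proof.
move=> uJ J0 Jk.
have [P0 [nzP0 P0J P0k]] := exists_vanishing_poly Jk.
have [P [PJ PP0 [x xJ [i Pxi]]]] := regular_vanishing_poly J0 nzP0 P0J.
exists x => //; apply: contrapT => rich.
have bad j : exists l, [/\ L j l, l x &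
    forall U, has_direction l U -> forall v, v \in U -> dir_deriv P x v = 0].
  apply: contrapT => nbad; apply: rich; exists j => l Ll lx.
  have [U dimU lU] := L_line Ll.
  rewrite -ltnS; apply: leq_trans (leq_trans PP0 P0k).
  apply: contrapT => few; apply: nbad; exists l; split=> // V lV v vV.
  apply/eqP/negPn/negP => gv; apply: few.
  apply: (count_line_lt uJ PJ dimU lU lx _ gv).
  by rewrite (has_direction_inj lU lV).
have [l lP] := choice bad.
have [U lU sumU] := L_generic (fun j => let: And3 a _ _ := lP j in a)
  (fun j => let: And3 _ a _ := lP j in a).
case/eqP: Pxi; apply: (gradient_eq0_of_full_span sumU) => j v.
by have [_ _] := lP j; apply.
Qed.

(** Removing the point [x] of [exists_point_on_poor_lines] first and colouring it
    last, a line of its colour class through [x] is bounded by all its points in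
    [J], whatever the colours given to the others. *)
Lemma exists_colouring k J : (0 < d)%N -> uniq J -> (size J < k.+1 ^ d)%N ->
  exists kappa : 'rV[F]_d -> 'I_d, forall j l, L j l ->
    (count (fun y => `[< l y >] && (kappa y == j)) J <= d * k)%N.
Proof.
move=> d_gt0; have [n] := ubnP (size J); elim: n J => // n IH J Jn uJ Jk.
have [->|J0] := eqVneq J [::]; first by exists (fun=> Ordinal d_gt0).
have [x xJ [j0 poor]] := exists_point_on_poor_lines uJ J0 Jk.
have sz : (size (rem x J) < size J)%N.
  by rewrite size_rem // prednK // -has_predT; apply/hasP; exists x.
have [||kappa kappaP] := IH (rem x J) _ (rem_uniq x uJ).
- exact: leq_trans sz _.
- exact: ltn_trans sz Jk.
exists (fun y => if y == x then j0 else kappa y) => j l Ll.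
have [/andP [/asboolP lx /eqP jE]|off] := boolP (`[< l x >] && (j0 == j)).
  rewrite -jE in Ll *; apply: leq_trans (poor l Ll lx).
  by apply: sub_count => y /andP [].
have /permP -> := perm_to_rem xJ.
rewrite /= eqxx (negPf off) add0n.
rewrite (eq_in_count (a2 := fun y => `[< l y >] && (kappa y == j))) ?kappaP //.
by move=> y; rewrite mem_rem_uniq // inE => /andP [/negPf ->].
Qed.

End Colouring.

Theorem theorem1 (R : realType) (d : nat) (d_gt0 : (0 < d)%N) :
  exists C : R,
    forall (F : fieldType) (L : 'I_d -> set (set 'rV[F]_d)),
      (forall j l, L j l -> is_line l) ->
      trivIset [set: 'I_d] L ->
      generic L ->
      forall J : {fset 'rV[F]_d},
        (forall x, x \in J -> multijoint L x) ->
        exists kappa : J -> 'I_d,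
          forall (j : 'I_d) (l : set 'rV[F]_d), L j l ->
            #|[pred x : J | `[< l (val x) >] && (kappa x == j)]|%:R
              <= C * #|` J|%:R `^ (d%:R^-1).
Proof.
exists d%:R => F L L_line _ L_generic J _.
have d0 : d%:R != 0 :> R by rewrite pnatr_eq0 -lt0n.
have [k Jk kJ] : exists2 k, (#|` J| < k.+1 ^ d)%N & (k ^ d <= #|` J|)%N.
  have ex0 : exists k, (k ^ d <= #|` J|)%N by exists 0%N; rewrite exp0n.
  have bnd k : (k ^ d <= #|` J|)%N -> (k <= #|` J|)%N.
    by apply: leq_trans; case: k => // k; rewrite -[leqLHS]expn1 leq_pexp2l.
  case: (ex_maxnP ex0 bnd) => k kJ kmax; exists k => //.
  by rewrite ltnNge; apply/negP => /kmax; rewrite ltnn.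
have [kappa kappaP] := exists_colouring L_line L_generic d_gt0 (fset_uniq J) Jk.
exists (fun x => kappa (val x)) => j l Ll.
have -> : #|[pred x : J | `[< l (val x) >] && (kappa (val x) == j)]|
        = count (fun y => `[< l y >] && (kappa y == j)) J.
  by rewrite [in RHS]enum_fsetE count_map cardE -size_filter enumT.
apply: le_trans (_ : (d * k)%:R <= _); first by rewrite ler_nat kappaP.
rewrite natrM ler_wpM2l //.
have kE : k%:R = (k%:R ^+ d) `^ d%:R^-1 :> R.
  by rewrite -powR_mulrn // -powRrM mulfV // powRr1.
rewrite kE; apply: ge0_ler_powR; rewrite ?nnegrE ?invr_ge0 ?exprn_ge0 //.
by rewrite -natrX ler_nat.
Qed.
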